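(* Let $f$, $M$ satisfy the standing assumptions (1)–(3) of the context, suppose moreover that $\nabla^2 f(X)$ exists at every $X\in\mathbb{R}^{n\times p}$, and suppose $\beta\ge\tilde\beta$. Then $h$ and the constrained problem (P) have the same second-order stationary points over $\mathbb{R}^{n\times p}$: a matrix $X\in\mathbb{R}^{n\times p}$ is a second-order stationary point of $h$ if and only if it is a second-order stationary point of (P).
   Context: Let $1\le p\le n$ be integers, $f:\mathbb{R}^{n\times p}\to\mathbb{R}$ with $f(X)=\mathbb{E}_{\xi\sim\Xi}[f_\xi(X)]$, and $M=\mathbb{E}_{\theta\sim\Theta}[M_\theta]\in\mathbb{R}^{n\times n}$, where $\xi,\theta$ are random vectors with distributions $\Xi,\Theta$. Standing assumptions: (1) $f$ is differentiable and $\nabla f$ is globally $L_g$-Lipschitz continuous on $\mathbb{R}^{n\times p}$; (2) for almost every $\xi$, $f_\xi$ is differentiable, and $\mathbb{E}_{\xi\sim\Xi}[\nabla f_\xi(X)]=\nabla f(X)$ for all $X$; (3) $M$ is symmetric positive definite. Problem (P): minimize $f(X)$ over $X\in\mathcal{S}_M(n,p):=\{X\in\mathbb{R}^{n\times p}:X^\top MX=I_p\}$. Notation: $\|\cdot\|$ is the Frobenius norm, $\langle X,Y\rangle=\operatorname{tr}(X^\top Y)$; $\sigma_{\max}(\cdot),\sigma_{\min}(\cdot)$ are the largest and smallest singular values; $\kappa(M)=\sigma_{\max}(M)/\sigma_{\min}(M)$; $L_0:=\|\nabla f(0)\|$; $\Psi(A):=\tfrac12(A+A^\top)$. Define $\mathcal{A}(X):=X\left(\tfrac32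 I_p-\tfrac12X^\top MX\right)$ and, for a penalty parameter $\beta>0$, $$h(X):=f(\mathcal{A}(X))+\frac{\beta}{6}\operatorname{tr}\left(X^\top MX\left((X^\top MX)^2-3I_p\right)\right).$$ $\tilde\beta$ denotes a constant satisfying $$\tilde\beta\ge\frac{12\,\kappa(M)\left(3(p+1)L_g+\sigma_{\min}(M)^{1/2}L_0\right)}{\sigma_{\min}(M)}.$$ $X$ is a first-order stationary point of (P) iff $X^\top MX=I_p$ and $\nabla f(X)-MX\Psi(X^\top\nabla f(X))=0$. $X$ is a second-order stationary point of (P) iff it is a first-order stationary point of (P) and $$\langle T,\nabla^2f(X)[T]-MTX^\top\nabla f(X)\rangle\ge0\quad\text{for all }T\in\mathcal{T}(X):=\{T\in\mathbb{R}^{n\times p}:\Psi(T^\top MX)=0\}.$$ $X$ is a second-order stationary point of $h$ iff $\nabla h(X)=0$ and $\langle D,\nabla^2h(X)[D]\rangle\ge0$ for all $D\in\mathbb{R}^{n\times p}$. *)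

(* Defs.v *)
From HB Require Import structures.
From mathcomp Require Import all_boot all_order all_algebra.
From mathcomp Require Import all_classical all_reals all_analysis.

Set Implicit Arguments.
Unset Strict Implicit.
Unset Printing Implicit Defensive.

Import Order.TTheory GRing.Theory Num.Theory.
Import numFieldNormedType.Exports.

Local Open Scope classical_set_scope.
Local Open Scope ring_scope.

Section MatrixNotions.
Context {R : realType}.

Definition frob_dot {n p} (X Y : 'M[R]_(n, p)) : R := \tr (X^T *m Y).

(* The library norm `|X| on matrices is the sup norm. *)
Definition frob_norm {n p} (X : 'M[R]_(n, p)) : R := Num.sqrt (frob_dot X X).

Definition symm_part {p} (A : 'M[R]_p) : 'M[R]_p := 2^-1 *: (A + A^T).

Definition sym_posdef {n} (M : 'M[R]_n) : Prop :=
  M^T = M /\ forall v : 'cV[R]_n, v != 0 -> 0 < (v^T *m M *m v) 0 0.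

(* Square matrices only: if A had more columns than rows, A^T A would have
   zero eigenvalues that are not squares of singular values of A. *)
Definition singular_values {n} (A : 'M[R]_n) : set R :=
  [set s | 0 <= s /\ eigenvalue (A^T *m A) (s ^+ 2)].

(* For 0 < n the set of singular values is finite and nonempty, so sup and inf
   are its maximum and minimum. *)
Definition sigma_max {n} (A : 'M[R]_n) : R := sup (singular_values A).
Definition sigma_min {n} (A : 'M[R]_n) : R := inf (singular_values A).
Definition cond_number {n} (A : 'M[R]_n) : R := sigma_max A / sigma_min A.

(* Gradient for the Frobenius inner product: when g is differentiable at X,
   'd g X D = frob_dot (grad g X) D for all D. *)
Definition grad {n p} (g : 'M[R]_(n, p) -> R) (X : 'M[R]_(n, p))
    : 'M[R]_(n, p) :=
  \matrix_(i, j) ('d g X : 'M[R]_(n, p) -> R) (delta_mx i j).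

(* The Hessian as an operator: D |-> nabla^2 g(X)[D]. *)
Definition hess {n p} (g : 'M[R]_(n, p) -> R) (X D : 'M[R]_(n, p))
    : 'M[R]_(n, p) :=
  ('d (grad g) X : 'M[R]_(n, p) -> 'M[R]_(n, p)) D.

Definition hess_exists {n p} (g : 'M[R]_(n, p) -> R) (X : 'M[R]_(n, p))
    : Prop :=
  (\forall Y \near X, differentiable g Y) /\ differentiable (grad g) X.

(* Z is integrable with expectation a. The almost-everywhere equal Y allows Z
   to be arbitrary (even nonmeasurable) on a null set, as is needed for
   gradients that exist only almost surely. *)
Definition has_mean {d : measure_display} {T : measurableType d}
    (P : probability T R) (Z : T -> R) (a : R) : Prop :=
  exists Y : T -> R,
    [/\ {ae P, forall t, Z t = Y t},
        P.-integrable setT (EFin \o Y) & ('E_P[Y] = a%:E)%E].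

Definition has_mean_mx {d : measure_display} {T : measurableType d} {n p}
    (P : probability T R) (Z : T -> 'M[R]_(n, p)) (A : 'M[R]_(n, p)) : Prop :=
  forall i j, has_mean P (fun t => Z t i j) (A i j).

Definition calA {n p} (M : 'M[R]_n) (X : 'M[R]_(n, p)) : 'M[R]_(n, p) :=
  X *m ((3 / 2)%:M - 2^-1 *: (X^T *m M *m X)).

Definition hpen {n p} (f : 'M[R]_(n, p) -> R) (M : 'M[R]_n) (beta : R)
    (X : 'M[R]_(n, p)) : R :=
  let S := X^T *m M *m X in
  f (calA M X) + beta / 6 * \tr (S *m (S *m S - 3%:M)).

Definition fosp_P {n p} (f : 'M[R]_(n, p) -> R) (M : 'M[R]_n)
    (X : 'M[R]_(n, p)) : Prop :=
  X^T *m M *m X = 1%:M /\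
  grad f X - M *m X *m symm_part (X^T *m grad f X) = 0.

Definition tangent {n p} (M : 'M[R]_n) (X : 'M[R]_(n, p))
    : set 'M[R]_(n, p) :=
  [set T | symm_part (T^T *m M *m X) = 0].

Definition sosp_P {n p} (f : 'M[R]_(n, p) -> R) (M : 'M[R]_n)
    (X : 'M[R]_(n, p)) : Prop :=
  fosp_P f M X /\
  forall T, tangent M X T ->
    0 <= frob_dot T (hess f X T - M *m T *m X^T *m grad f X).

(* hess_exists records that the gradient and the Hessian in the two conditions
   are genuine derivatives. *)
Definition sosp {n p} (g : 'M[R]_(n, p) -> R) (X : 'M[R]_(n, p)) : Prop :=
  [/\ hess_exists g X, grad g X = 0 & forall D, 0 <= frob_dot D (hess g X D)].

End MatrixNotions.

(* Main.v *)
Require Import Defs.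
From HB Require Import structures.
From mathcomp Require Import all_boot all_order all_algebra.
From mathcomp Require Import all_classical all_reals all_analysis.
From mathcomp Require Import ring lra.

(** Write S = X^T M X, P(T) for the symmetric part of T, G for the gradient of f
    at calA M X and sigma for the smallest singular value of M. The chain rule
    gives
      grad h(X) = G (3/2 - S/2) - M X P(X^T G) + beta M X (S^2 - 1),
    and the quadratic form of the Hessian of h follows by differentiating once
    more (hess_hpen_quad).

    If X is feasible, that is S = 1, then calA M X = X and grad h(X) is the
    residual of the first-order condition of (P). Every direction splits as
    D = T + X Q with T tangent and Q symmetric, and at a first-order point
      <D, Hess h D> = <T, Hess f T - M T X^T G> + 4 beta |Q|^2 - 3 <Q, L Q>,
    where L = P(X^T G) is the multiplier (hess_hpen_feasible). Tangent directions
    give the second-order condition of (P); the normal part is nonnegative as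
    soon as the largest eigenvalue of L is at most 4/3 beta, which holds because
    the gradient of f is Lipschitz and feasible matrices are bounded
    (rayleigh_grad_le).

    It remains to see that a second-order stationary point of h is feasible
    (sosp_hpen_feasible). Let u be a unit eigenvector of S with eigenvalue s, and
    g = <X u u^T, G>. Pairing grad h(X) = 0 with X u u^T gives
      (1 - s) (3/2 g - beta s (s + 1)) = 0.
    For s > 1 the largest eigenvalue, the Lipschitz bound on G yields
    12 g <= beta s^2, which is incompatible. For 0 < s < 1, the Hessian of h in
    the direction X u u^T is at most
      s (9/4 (1 - s)^2 Lg / sigma - beta (1 - s) (3 s + 1)) < 0.
    For s = 0 one has X u = 0, and a direction w^T u^T with w M X = 0 has negative
    curvature. So 1 is the only eigenvalue of the symmetric matrix S. Just the two
    extreme eigenpairs of S enter, and they are obtained by minimizing a quadratic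
    form on the unit sphere (sym_min_eigen). *)

Set Implicit Arguments.
Unset Strict Implicit.
Unset Printing Implicit Defensive.

Import Order.TTheory GRing.Theory Num.Theory.
Import numFieldNormedType.Exports.

Local Open Scope classical_set_scope.
Local Open Scope ring_scope.

(** * Differential calculus for matrix-valued maps *)

Section Diff.
Context {R : realType} {V : normedModType R}.

Lemma is_diff_coord {m n} (F dF : V -> 'M[R]_(m, n)) (x : V) i j :
  is_diff x F dF -> is_diff x (fun y => F y i j) (fun d => dF d i j).
Proof.
move=> hF.
have hc : is_diff (F x) (fun N : 'M[R]_(m, n) => N i j : R) (fun N => N i j : R).
  pose coord (N : 'M[R]_(m, n)) : R := N i j.
  have lin : linear coord by move=> a A B; rewrite /coord !mxE.
  pose linM := GRing.isLinear.Build _ _ _ _ _ lin.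
  pose f : {linear 'M[R]_(m, n) -> R} := HB.pack coord linM.
  apply: DiffDef.
    exact: (@linear_differentiable _ _ _ f _ (@coord_continuous _ _ _ i j)).
  exact: (@diff_lin _ _ _ f _ (@coord_continuous _ _ _ i j)).
exact: (is_diff_comp hF hc).
Qed.

Lemma is_diff_sum {W : normedModType R} (I : Type) (r : seq I)
    (F dF : I -> V -> W) (x : V) :
  (forall i, is_diff x (F i) (dF i)) ->
  is_diff x (fun y => \sum_(i <- r) F i y) (fun d => \sum_(i <- r) dF i d).
Proof.
move=> h; elim: r => [|a r IH].
  have -> : (fun y => \sum_(i <- [::]) F i y) = cst 0.
    by apply/funext => y; rewrite big_nil.
  have -> : (fun y => \sum_(i <- [::]) dF i y) = 0.
    by apply/funext => y; rewrite big_nil.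
  exact: is_diff_cst.
have -> : (fun y => \sum_(i <- a :: r) F i y) = F a + (fun y => \sum_(i <- r) F i y).
  by apply/funext => y; rewrite big_cons.
have -> : (fun y => \sum_(i <- a :: r) dF i y) = dF a + (fun y => \sum_(i <- r) dF i y).
  by apply/funext => y; rewrite big_cons.
exact: is_diffD.
Qed.

(** Decomposing along the matrix units reduces differentiability to the entries,
    so the rules for products and transposes come from those for scalars. *)
Lemma is_diff_mx {m n} (F dF : V -> 'M[R]_(m, n)) (x : V) :
  (forall i j, is_diff x (fun y => F y i j) (fun d => dF d i j)) ->
  is_diff x F dF.
Proof.
move=> h.
have e (G : V -> 'M[R]_(m, n)) :
   G = (fun y => \sum_i \sum_j G y i j *: delta_mx i j).
  by apply/funext => y; rewrite -matrix_sum_delta.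
rewrite (e F) (e dF).
apply: is_diff_sum => i; apply: is_diff_sum => j.
exact: (is_diff_comp (h i j) (is_diff_scalel (F x i j) (delta_mx i j : 'M[R]_(m, n)))).
Qed.

Lemma is_diff_mulmx {m n k} (F dF : V -> 'M[R]_(m, n)) (G dG : V -> 'M[R]_(n, k))
    (x : V) : is_diff x F dF -> is_diff x G dG ->
  is_diff x (fun y => F y *m G y) (fun d => F x *m dG d + dF d *m G x).
Proof.
move=> hF hG; apply: is_diff_mx => i j.
have -> : (fun y => (F y *m G y) i j) = (fun y => \sum_l F y i l * G y l j).
  by apply/funext => y; rewrite mxE.
have -> : (fun d => (F x *m dG d + dF d *m G x) i j) =
    (fun d => \sum_l (F x i l * dG d l j + dF d i l * G x l j)).
  by apply/funext => y; rewrite !mxE big_split.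
apply: is_diff_sum => l.
have := is_diffM (is_diff_coord i l hF) (is_diff_coord l j hG).
move=> h; apply: (is_diff_eq h); apply/funext => d.
by rewrite -[LHS]/(F x i l * dG d l j + G x l j * dF d i l) [G x l j * _]mulrC.
Qed.

Lemma is_diff_trmx {m n} (F dF : V -> 'M[R]_(m, n)) (x : V) :
  is_diff x F dF -> is_diff x (fun y => (F y)^T) (fun d => (dF d)^T).
Proof.
move=> hF; apply: is_diff_mx => i j.
have h := is_diff_coord j i hF.
have -> : (fun y => (F y)^T i j) = (fun y => F y j i).
  by apply/funext => y; rewrite mxE.
apply: (is_diff_eq h).
by apply/funext => y; rewrite mxE.
Qed.

Lemma is_diff_mxtrace {n} (F dF : V -> 'M[R]_n) (x : V) :
  is_diff x F dF -> is_diff x (fun y => \tr (F y)) (fun d => \tr (dF d)).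
Proof.
by move=> hF; apply: is_diff_sum => i; exact: is_diff_coord.
Qed.

End Diff.

Section Grad.
Context {R : realType} {n p : nat}.
Implicit Types (g : 'M[R]_(n, p) -> R) (X D : 'M[R]_(n, p)).

Lemma frob_dotE X D : frob_dot X D = \sum_i \sum_j X i j * D i j.
Proof.
rewrite /frob_dot /mxtrace exchange_big; apply: eq_bigr => j _.
by rewrite mxE; apply: eq_bigr => i _; rewrite mxE.
Qed.

(** A linear map is determined by its values on the matrix units. *)
Lemma diff_grad g X D : 'd g X D = frob_dot (grad g X) D.
Proof.
rewrite [in LHS](matrix_sum_delta D) linear_sum frob_dotE.
apply: eq_bigr => i _; rewrite linear_sum; apply: eq_bigr => j _.
by rewrite linearZ /= !mxE mulrC.
Qed.

Lemma frob_dot_delta X i j : frob_dot X (delta_mx i j) = X i j.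
Proof.
rewrite frob_dotE (bigD1 i) //= (bigD1 j) //= mxE !eqxx mulr1 !big1 ?addr0 //.
  by move=> k ki; apply: big1 => l _; rewrite mxE (negbTE ki) mulr0.
by move=> k kj; rewrite mxE (negbTE kj) andbF mulr0.
Qed.

Lemma grad_unique g X L W : is_diff X g L ->
  (forall D, L D = frob_dot W D) -> grad g X = W.
Proof.
move=> [_ e] h; apply/matrixP => i j.
by rewrite mxE e h frob_dot_delta.
Qed.

End Grad.

(** * The Frobenius inner product *)

Section FrobDot.
Context {R : realType}.

Lemma frob_dotC {n p} (A B : 'M[R]_(n, p)) : frob_dot A B = frob_dot B A.
Proof.
by rewrite !frob_dotE; do 2!apply: eq_bigr => ? _; rewrite mulrC.
Qed.

Lemma frob_dotDr {n p} (A B C : 'M[R]_(n, p)) :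
  frob_dot A (B + C) = frob_dot A B + frob_dot A C.
Proof. by rewrite /frob_dot mulmxDr mxtraceD. Qed.

Lemma frob_dotZr {n p} a (A B : 'M[R]_(n, p)) :
  frob_dot A (a *: B) = a * frob_dot A B.
Proof. by rewrite /frob_dot -scalemxAr mxtraceZ. Qed.

Lemma frob_dotNr {n p} (A B : 'M[R]_(n, p)) : frob_dot A (- B) = - frob_dot A B.
Proof. by rewrite -scaleN1r frob_dotZr mulN1r. Qed.

Lemma frob_dotBr {n p} (A B C : 'M[R]_(n, p)) :
  frob_dot A (B - C) = frob_dot A B - frob_dot A C.
Proof. by rewrite frob_dotDr frob_dotNr. Qed.

Lemma frob_dotDl {n p} (A B C : 'M[R]_(n, p)) :
  frob_dot (B + C) A = frob_dot B A + frob_dot C A.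
Proof. by rewrite !(frob_dotC _ A) frob_dotDr. Qed.

Lemma frob_dotZl {n p} a (A B : 'M[R]_(n, p)) :
  frob_dot (a *: B) A = a * frob_dot B A.
Proof. by rewrite !(frob_dotC _ A) frob_dotZr. Qed.

Lemma frob_dotNl {n p} (A B : 'M[R]_(n, p)) : frob_dot (- A) B = - frob_dot A B.
Proof. by rewrite -scaleN1r frob_dotZl mulN1r. Qed.

Lemma frob_dotBl {n p} (A B C : 'M[R]_(n, p)) :
  frob_dot (B - C) A = frob_dot B A - frob_dot C A.
Proof. by rewrite frob_dotDl frob_dotNl. Qed.

Lemma frob_dot0r {n p} (A : 'M[R]_(n, p)) : frob_dot A 0 = 0.
Proof. by rewrite /frob_dot mulmx0 mxtrace0. Qed.

Lemma frob_dot0l {n p} (A : 'M[R]_(n, p)) : frob_dot 0 A = 0.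
Proof. by rewrite frob_dotC frob_dot0r. Qed.

Lemma frob_dotMl {n m p} (A : 'M[R]_(n, m)) (B : 'M[R]_(m, p)) C :
  frob_dot (A *m B) C = frob_dot B (A^T *m C).
Proof. by rewrite /frob_dot trmx_mul mulmxA. Qed.

Lemma frob_dotMr {n m p} (A : 'M[R]_(n, m)) (B : 'M[R]_(m, p)) C :
  frob_dot (A *m B) C = frob_dot A (C *m B^T).
Proof. by rewrite /frob_dot trmx_mul -mulmxA mxtrace_mulC mulmxA. Qed.

Lemma frob_dot_trmx {n p} (A B : 'M[R]_(n, p)) : frob_dot A^T B^T = frob_dot A B.
Proof. by rewrite frob_dotC /frob_dot trmxK mxtrace_mulC. Qed.

Lemma symm_part_sym {p} (A : 'M[R]_p) : (symm_part A)^T = symm_part A.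
Proof. by rewrite /symm_part linearZ /= linearD /= trmxK addrC. Qed.

Lemma frob_dot_symm {p} (K B : 'M[R]_p) : K^T = K ->
  frob_dot K (symm_part B) = frob_dot K B.
Proof.
move=> hK; rewrite frob_dotZr frob_dotDr -(frob_dot_trmx K B^T) hK trmxK.
by lra.
Qed.

Lemma frob_dot_ge0 {n p} (A : 'M[R]_(n, p)) : 0 <= frob_dot A A.
Proof. by rewrite frob_dotE; do 2!apply: sumr_ge0 => ? _; rewrite -expr2 sqr_ge0. Qed.

Lemma frob_dot_eq0 {n p} (A : 'M[R]_(n, p)) : (frob_dot A A == 0) = (A == 0).
Proof.
apply/idP/eqP => [|->]; last by rewrite /frob_dot mulmx0 mxtrace0.
rewrite frob_dotE psumr_eq0 => [/allP h|i _]; last first.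
  by apply: sumr_ge0 => ? _; rewrite -expr2 sqr_ge0.
apply/matrixP => i j; rewrite mxE.
have := h i (mem_index_enum i); rewrite psumr_eq0 => [/allP h'|k _]; last first.
  by rewrite -expr2 sqr_ge0.
by have := h' j (mem_index_enum j); rewrite /= -expr2 sqrf_eq0 => /eqP.
Qed.

Lemma frob_norm_ge0 {n p} (A : 'M[R]_(n, p)) : 0 <= frob_norm A.
Proof. exact: sqrtr_ge0. Qed.

Lemma frob_norm_sqr {n p} (A : 'M[R]_(n, p)) : frob_norm A ^+ 2 = frob_dot A A.
Proof. by rewrite sqr_sqrtr // frob_dot_ge0. Qed.

(** Cauchy-Schwarz: expand the square of |B| A - |A| B. *)
Lemma frob_dot_le {n p} (A B : 'M[R]_(n, p)) :
  frob_dot A B <= frob_norm A * frob_norm B.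
Proof.
have := frob_norm_ge0 A; rewrite le_eqVlt eq_sym => /orP[/eqP a0|a0].
  have /eqP : frob_dot A A = 0 by rewrite -frob_norm_sqr a0 expr0n.
  rewrite frob_dot_eq0 => /eqP ->.
  by rewrite frob_dotC /frob_dot mulmx0 mxtrace0 mulr_ge0 ?frob_norm_ge0.
have := frob_norm_ge0 B; rewrite le_eqVlt eq_sym => /orP[/eqP b0|b0].
  have /eqP : frob_dot B B = 0 by rewrite -frob_norm_sqr b0 expr0n.
  rewrite frob_dot_eq0 => /eqP ->.
  by rewrite /frob_dot mulmx0 mxtrace0 mulr_ge0 ?frob_norm_ge0.
have := frob_dot_ge0 (frob_norm B *: A - frob_norm A *: B).
rewrite frob_dotBl !frob_dotBr !frob_dotZl !frob_dotZr (frob_dotC B A).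
rewrite -!frob_norm_sqr => h.
have ab : 0 < frob_norm A * frob_norm B by rewrite mulr_gt0.
rewrite -(ler_pM2l ab).
move: h; set a := frob_norm A; set b := frob_norm B; set c := frob_dot A B.
nra.
Qed.

Lemma frob_normD {n p} (A B : 'M[R]_(n, p)) :
  frob_norm (A + B) <= frob_norm A + frob_norm B.
Proof.
rewrite -(@ler_pXn2r _ 2) ?nnegrE ?addr_ge0 ?frob_norm_ge0 //.
rewrite frob_norm_sqr sqrrD !frob_norm_sqr frob_dotDl !frob_dotDr (frob_dotC B A).
have := frob_dot_le A B; lra.
Qed.

Lemma frob_normZ {n p} a (A : 'M[R]_(n, p)) : frob_norm (a *: A) = `|a| * frob_norm A.
Proof.
by rewrite /frob_norm frob_dotZl frob_dotZr mulrA -expr2 sqrtrM ?sqr_ge0 // sqrtr_sqr.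
Qed.

Lemma unit_col_mul {p} (u : 'cV[R]_p) : frob_dot u u = 1 -> u^T *m u = 1%:M.
Proof.
move=> u1; apply/matrixP => i j; rewrite !ord1 [RHS]mxE eqxx mulr1n -u1.
by rewrite /frob_dot /mxtrace big_ord1.
Qed.

End FrobDot.

(** * Gradient and Hessian of the penalty function *)

Section PenaltyDerivatives.
Context {R : realType} {n p : nat} (f : 'M[R]_(n, p) -> R) (M : 'M[R]_n) (beta : R).
Context (M_sym : M^T = M) (f_hess : forall X, hess_exists f X).
Implicit Types X D : 'M[R]_(n, p).

(** The quantity S of the proof sketch; feasibility reads gram X = 1. *)
Definition gram X : 'M[R]_p := X^T *m M *m X.
Definition dgram X D : 'M[R]_p := X^T *m M *m D + D^T *m M *m X.
Definition calA_factor X : 'M[R]_p := (3 / 2)%:M - 2^-1 *: gram X.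
Definition dcalA X D : 'M[R]_(n, p) := D *m calA_factor X - 2^-1 *: (X *m dgram X D).
Definition gradA X := grad f (calA M X).
(** The adjoint of D |-> dcalA X D for the Frobenius inner product, see
    dcalA_adjE; it turns the gradient of f into that of f \o calA M. *)
Definition dcalA_adj X (G : 'M[R]_(n, p)) :=
  G *m calA_factor X - M *m X *m symm_part (X^T *m G).
Definition hpen_grad X :=
  dcalA_adj X (gradA X) + beta *: (M *m X *m (gram X *m gram X - 1%:M)).

Lemma gram_sym X : (gram X)^T = gram X.
Proof. by rewrite /gram !trmx_mul trmxK M_sym mulmxA. Qed.

Lemma dgram_symm X D : dgram X D = 2 *: symm_part (X^T *m M *m D).
Proof.
rewrite /symm_part scalerA mulfV ?pnatr_eq0 // scale1r.
by rewrite !trmx_mul trmxK M_sym mulmxA.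
Qed.

Lemma dgram_sym X D : (dgram X D)^T = dgram X D.
Proof. by rewrite dgram_symm linearZ /= symm_part_sym. Qed.

Lemma calA_factor_sym X : (calA_factor X)^T = calA_factor X.
Proof. by rewrite /calA_factor linearB /= linearZ /= gram_sym tr_scalar_mx. Qed.

(** A symmetric K sees the two halves of dgram, which are transposes of each
    other, in the same way. *)
Lemma frob_dot_dgram X D K : K^T = K ->
  frob_dot K (dgram X D) = 2 * frob_dot D (M *m X *m K).
Proof.
move=> hK; rewrite dgram_symm frob_dotZr frob_dot_symm //; congr (_ * _).
by rewrite frob_dotC !frob_dotMl !trmx_mul trmxK M_sym.
Qed.

Lemma dcalA_adjE X D G : frob_dot (dcalA X D) G = frob_dot D (dcalA_adj X G).
Proof.
rewrite /dcalA /dcalA_adj frob_dotBl frob_dotBr; congr (_ - _).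
  by rewrite frob_dotMr calA_factor_sym.
rewrite frob_dotZl frob_dotMl -(frob_dot_symm _ (dgram_sym X D)) frob_dotC.
by rewrite frob_dot_dgram ?symm_part_sym // mulrA mulVf ?mul1r.
Qed.

Lemma is_diff_gram X : is_diff X gram (dgram X).
Proof.
have h := is_diff_mulmx (is_diff_mulmx (is_diff_trmx (is_diff_id X))
   (is_diff_cst M X)) (is_diff_id X).
by apply: (is_diff_eq h); apply/funext => D; rewrite /dgram /= mulmx0 add0r.
Qed.

Lemma is_diff_calA_factor X : is_diff X calA_factor (fun D => - (2^-1 *: dgram X D)).
Proof.
have h := is_diffB (is_diff_cst ((3 / 2)%:M : 'M[R]_p) X)
   (is_diffZ 2^-1 (is_diff_gram X)).
by apply: (is_diff_eq h); apply/funext => D; rewrite -[LHS]/(0 - _) sub0r.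
Qed.

Lemma is_diff_calA X : is_diff X (calA M) (dcalA X).
Proof.
have h := is_diff_mulmx (is_diff_id X) (is_diff_calA_factor X).
apply: (is_diff_eq h); apply/funext => D.
by rewrite /dcalA /= mulmxN scalemxAr addrC.
Qed.

(** The trace term has differential tr (3 (S^2 - 1) dS) by cyclicity of the
    trace; since S^2 - 1 is symmetric, frob_dot_dgram rewrites it as the inner
    product of D with 6 M X (S^2 - 1). *)
Lemma is_diff_hpen X : is_diff X (hpen f M beta) (fun D => frob_dot (hpen_grad X) D).
Proof.
have hf : is_diff (calA M X) f ('d f (calA M X)).
  by apply: differentiableP; case: (f_hess (calA M X)) => /nbhs_singleton.
have h1 := is_diff_comp (is_diff_calA X) hf.
have hS := is_diff_gram X.
have hS3 := is_diffB (is_diff_mulmx hS hS) (is_diff_cst (3%:M : 'M[R]_p) X).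
have h2 := is_diffZ (beta / 6) (is_diff_mxtrace (is_diff_mulmx hS hS3)).
apply: (is_diff_eq (is_diffD h1 h2)); apply/funext => D.
rewrite -[LHS]/('d f (calA M X) (dcalA X D) + beta / 6 *
  \tr (gram X *m (gram X *m dgram X D + dgram X D *m gram X - 0) +
   dgram X D *m (gram X *m gram X - 3%:M))).
rewrite diff_grad subr0 frob_dotC dcalA_adjE (frob_dotC (hpen_grad X)).
rewrite /hpen_grad [RHS]frob_dotDr.
congr (_ + _); rewrite frob_dotZr.
have hs : (gram X *m gram X - 1%:M)^T = gram X *m gram X - 1%:M.
  by rewrite linearB /= trmx_mul gram_sym trmx1.
have -> : frob_dot D (M *m X *m (gram X *m gram X - 1%:M)) =
   2^-1 * frob_dot (gram X *m gram X - 1%:M) (dgram X D).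
  by rewrite frob_dot_dgram // mulrA mulVf ?mul1r ?pnatr_eq0.
rewrite /frob_dot hs mulmxDr mulmxBr mulmxBl !mxtraceD mul1mx.
rewrite !raddfN /= (mxtrace_mulC (dgram X D)) (mulmxA (gram X) (dgram X D)).
rewrite (mxtrace_mulC (gram X *m dgram X D) (gram X)).
rewrite !mulmxA mul_mx_scalar !mxtraceZ.
by field.
Qed.

Lemma grad_hpenE : grad (hpen f M beta) = hpen_grad.
Proof. by apply/funext => X; apply: grad_unique (is_diff_hpen X) _. Qed.

Lemma is_diff_symm {V : normedModType R} (F dF : V -> 'M[R]_p) x :
  is_diff x F dF -> is_diff x (fun y => symm_part (F y)) (fun d => symm_part (dF d)).
Proof. by move=> h; have := is_diffZ 2^-1 (is_diffD h (is_diff_trmx h)). Qed.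

Definition hpen_hess X D :=
  let G' := hess f (calA M X) (dcalA X D) in
  (gradA X *m - (2^-1 *: dgram X D) + G' *m calA_factor X
   - (M *m X *m symm_part (X^T *m G' + D^T *m gradA X)
     + M *m D *m symm_part (X^T *m gradA X)))
  + beta *: (M *m X *m (gram X *m dgram X D + dgram X D *m gram X)
     + M *m D *m (gram X *m gram X - 1%:M)).

Lemma is_diff_hpen_grad X : is_diff X hpen_grad (hpen_hess X).
Proof.
have hg : is_diff (calA M X) (grad f) ('d (grad f) (calA M X)).
  by apply: differentiableP; case: (f_hess (calA M X)).
have hG := is_diff_comp (is_diff_calA X) hg.
have hS := is_diff_gram X.
have hMX := is_diff_mulmx (is_diff_cst M X) (is_diff_id X).
have hXG := is_diff_symm (is_diff_mulmx (is_diff_trmx (is_diff_id X)) hG).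
have h1 := is_diffB (is_diff_mulmx hG (is_diff_calA_factor X)) (is_diff_mulmx hMX hXG).
have h2 := is_diffZ beta (is_diff_mulmx hMX (is_diffB (is_diff_mulmx hS hS)
   (is_diff_cst (1%:M : 'M[R]_p) X))).
apply: (is_diff_eq (is_diffD h1 h2)); apply/funext => D.
rewrite -[LHS]/(gradA X *m - (2^-1 *: dgram X D)
  + hess f (calA M X) (dcalA X D) *m calA_factor X
  - (M *m X *m symm_part (X^T *m hess f (calA M X) (dcalA X D) + D^T *m gradA X)
     + (M *m D + 0 *m X) *m symm_part (X^T *m gradA X))
  + beta *: (M *m X *m (gram X *m dgram X D + dgram X D *m gram X - 0)
     + (M *m D + 0 *m X) *m (gram X *m gram X - 1%:M))).
by rewrite mul0mx addr0 subr0.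
Qed.

Lemma hess_exists_hpen X : hess_exists (hpen f M beta) X.
Proof.
split.
  by apply: filterE => Y; exact: (@ex_diff _ _ _ _ _ _ _ (is_diff_hpen Y)).
rewrite grad_hpenE; exact: (@ex_diff _ _ _ _ _ _ _ (is_diff_hpen_grad X)).
Qed.

Lemma hess_hpenE X D : hess (hpen f M beta) X D = hpen_hess X D.
Proof. by rewrite /hess grad_hpenE; have [_ ->] := is_diff_hpen_grad X. Qed.

(** Only the quadratic form of the Hessian is needed. Moving dcalA onto D with
    dcalA_adjE gathers the two terms with the Hessian of f; the terms with the
    gradient of f come from differentiating dcalA_adj in X. *)
Lemma hess_hpen_quad X D : frob_dot D (hess (hpen f M beta) X D) =
  frob_dot (dcalA X D) (hess f (calA M X) (dcalA X D))
  - frob_dot (dgram X D) (D^T *m gradA X)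
  - frob_dot D (M *m D *m symm_part (X^T *m gradA X))
  + beta * (frob_dot D (M *m D *m (gram X *m gram X - 1%:M))
     + frob_dot (dgram X D) (gram X *m dgram X D)).
Proof.
rewrite hess_hpenE /hpen_hess.
set G' := hess _ _ _; set G := gradA X.
rewrite dcalA_adjE /dcalA_adj.
have -> : symm_part (X^T *m G' + D^T *m G) =
    symm_part (X^T *m G') + symm_part (D^T *m G).
  by rewrite /symm_part -scalerDr [(_ + _)^T]linearD /= addrACA.
rewrite !(mulmxDr (M *m X)) mulmxN -scalemxAr.
rewrite !(frob_dotDr, frob_dotNr, frob_dotZr).
have -> : frob_dot D (M *m X *m symm_part (D^T *m G)) =
   2^-1 * frob_dot (dgram X D) (D^T *m G).
  rewrite -(frob_dot_symm _ (dgram_sym X D)) (frob_dotC (dgram X D)).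
  by rewrite frob_dot_dgram ?symm_part_sym // mulrA mulVf ?mul1r ?pnatr_eq0.
have -> : frob_dot D (G *m dgram X D) = frob_dot (dgram X D) (D^T *m G).
  by rewrite frob_dotC frob_dotMl -frob_dot_trmx dgram_sym trmx_mul trmxK.
have -> : frob_dot D (M *m X *m (gram X *m dgram X D)) +
    frob_dot D (M *m X *m (dgram X D *m gram X)) =
    frob_dot (dgram X D) (gram X *m dgram X D).
  rewrite -frob_dotDr -mulmxDr.
  have -> : frob_dot D (M *m X *m (gram X *m dgram X D + dgram X D *m gram X)) =
      2^-1 * frob_dot (gram X *m dgram X D + dgram X D *m gram X) (dgram X D).
    have hs : (gram X *m dgram X D + dgram X D *m gram X)^T =
        gram X *m dgram X D + dgram X D *m gram X.
      rewrite [LHS]linearD /= (trmx_mul (gram X)) (trmx_mul (dgram X D)).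
      by rewrite gram_sym dgram_sym addrC.
    by rewrite (frob_dot_dgram _ _ hs) mulrA mulVf ?mul1r ?pnatr_eq0.
  rewrite frob_dotDl (frob_dotC (gram X *m _)) -(frob_dot_trmx (dgram X D *m gram X)).
  rewrite (trmx_mul (dgram X D)) gram_sym dgram_sym (frob_dotC (gram X *m _)).
  by lra.
by field.
Qed.

End PenaltyDerivatives.

(** * Extreme eigenpairs and singular values *)

Section Spectral.
Context {R : realType}.

(** The form at u - t B u is 0 - 2 t |B u|^2 + t^2 c, negative for small t > 0
    unless B u = 0; t = |B u|^2 / (c + 1) is small enough. *)
Lemma psd_ker {n k} (B : 'M[R]_n) (u : 'M[R]_(n, k)) : B^T = B ->
  (forall v : 'M[R]_(n, k), 0 <= frob_dot v (B *m v)) ->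
  frob_dot u (B *m u) = 0 -> B *m u = 0.
Proof.
move=> hB B0 hu; set z := B *m u.
apply/eqP; rewrite -frob_dot_eq0.
set a := frob_dot z z; set c := frob_dot z (B *m z).
have c0 : 0 <= c := B0 z.
have a0 : 0 <= a := frob_dot_ge0 z.
have c1 : 0 < c + 1 by rewrite ltr_wpDl.
have := B0 (u - (a / (c + 1)) *: z).
rewrite mulmxBr -scalemxAr frob_dotBl !frob_dotBr !frob_dotZl !frob_dotZr hu.
have -> : frob_dot u (B *m z) = a by rewrite -[X in X *m z]hB -frob_dotMl.
rewrite -/z -/a -/c; set t := a / (c + 1).
have ht : t * (c + 1) = a by rewrite mulfVK ?gt_eqF.
have t0 : 0 <= t by rewrite divr_ge0 // ltW.
move=> h; rewrite eq_le a0 andbT.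
have tt : t * a <= 0 by nra.
rewrite leNgt; apply/negP => ap.
have tp : 0 < t by rewrite divr_gt0.
by have := mulr_gt0 tp ap; rewrite ltNge tt.
Qed.

Lemma frob_dot_col {n k} (A B : 'M[R]_(n, k)) :
  frob_dot A B = \sum_j frob_dot (col j A) (col j B).
Proof.
rewrite frob_dotE exchange_big; apply: eq_bigr => j _.
by rewrite frob_dotE; apply: eq_bigr => i _; rewrite big_ord1 !mxE.
Qed.

Lemma quad_form_col {n} (S : 'M[R]_n) s :
  (forall v : 'cV[R]_n, s * frob_dot v v <= frob_dot v (S *m v)) ->
  forall k (Y : 'M[R]_(n, k)), s * frob_dot Y Y <= frob_dot Y (S *m Y).
Proof.
move=> h k Y; rewrite !frob_dot_col mulr_sumr; apply: ler_sum => j _.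
by rewrite !colE -mulmxA; apply: h.
Qed.

(** Rayleigh: the quadratic form attains its minimum s on the unit sphere, which
    is compact; S - s is then positive semidefinite with a null vector u for its
    form, so psd_ker gives S u = s u. The bound is stated for matrices Y because
    it is applied to directions of the search space. *)
Lemma sym_min_eigen {n} (S : 'M[R]_n) : (0 < n)%N -> S^T = S ->
  exists s (u : 'cV[R]_n), [/\ frob_dot u u = 1, S *m u = s *: u &
    forall k (Y : 'M[R]_(n, k)), s * frob_dot Y Y <= frob_dot Y (S *m Y)].
Proof.
case: n S => // n S _ hS.
pose q (w : 'rV[R]_n.+1) := \tr (w *m S *m w^T).
pose N (w : 'rV[R]_n.+1) := \tr (w *m w^T).
have qE w : q w = frob_dot w^T (S *m w^T) by rewrite /q /frob_dot trmxK mulmxA.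
have NE w : N w = frob_dot w^T w^T by rewrite /N /frob_dot trmxK.
have cN : continuous N.
  move=> w; have dw := is_diff_id w.
  have := is_diff_mxtrace (is_diff_mulmx dw (is_diff_trmx dw)).
  by case=> h _; exact: (differentiable_continuous h).
have cq : continuous q.
  move=> w; have dw := is_diff_id w.
  have dwS := is_diff_mulmx dw (is_diff_cst S w).
  have := is_diff_mxtrace (is_diff_mulmx dwS (is_diff_trmx dw)).
  by case=> h _; exact: (differentiable_continuous h).
have cK : compact [set w | N w = 1].
  apply: bounded_closed_compact.
    exists 1; split=> // c c1 w /= w1.
    rewrite -[`|w|]/(mx_norm w) mx_normrE; apply/bigmax_leP; split=> [|ij _]; first lra.
    have : w ij.1 ij.2 ^+ 2 <= 1.
      rewrite -w1 NE frob_dot_trmx frob_dotE (bigD1 ij.1) //= (bigD1 ij.2) //= -expr2.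
      rewrite -addrA lerDl addr_ge0 //.
        by apply: sumr_ge0 => k _; rewrite -expr2 sqr_ge0.
      by do 2!apply: sumr_ge0 => ? _; rewrite -expr2 sqr_ge0.
    have c0 : 0 <= c by lra.
    move=> w2; rewrite -(@ler_pXn2r _ 2) ?nnegrE ?normr_ge0 //.
    rewrite -normrX ger0_norm ?sqr_ge0 //; apply: le_trans w2 _; nra.
  have -> : [set w | N w = 1] = N @^-1` [set 1] by [].
  by apply: closed_comp => // w _; exact: cN.
have K0 : [set w | N w = 1] !=set0.
  exists (delta_mx 0 0); rewrite /= NE frob_dot_trmx frob_dot_delta mxE !eqxx //.
have [u uK umin] := compact_EVT_min K0 cK (continuous_subspaceT cq).
rewrite inE /= in uK.
have hq : forall v : 'cV[R]_n.+1, q u * frob_dot v v <= frob_dot v (S *m v).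
  move=> v; have [->|v0] := eqVneq v 0.
    by rewrite mulmx0 /frob_dot mulmx0 mxtrace0 mulr0.
  have vp : 0 < frob_dot v v by rewrite lt_neqAle frob_dot_ge0 eq_sym frob_dot_eq0 v0.
  pose a := (frob_norm v)^-1.
  have a2 : a ^+ 2 = (frob_dot v v)^-1 by rewrite exprVn frob_norm_sqr.
  have /umin : (a *: v)^T \in [set w | N w = 1].
    by rewrite inE /= NE trmxK frob_dotZl frob_dotZr mulrA -expr2 a2 mulVf ?gt_eqF.
  rewrite [q (a *: v)^T]qE trmxK -scalemxAr frob_dotZl frob_dotZr mulrA -expr2 a2.
  by rewrite ler_pdivlMl // mulrC.
exists (q u), u^T; split; last exact: quad_form_col.
  by rewrite -NE.
apply/eqP; rewrite -subr_eq0; apply/eqP.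
rewrite -mul_scalar_mx -mulmxBl; apply: psd_ker.
- by rewrite linearB /= hS tr_scalar_mx.
- by move=> v; rewrite mulmxBl mul_scalar_mx frob_dotBr frob_dotZr subr_ge0.
- by rewrite mulmxBl mul_scalar_mx frob_dotBr frob_dotZr -NE uK mulr1 -qE subrr.
Qed.

Lemma sym_max_eigen {n} (S : 'M[R]_n) : (0 < n)%N -> S^T = S ->
  exists s (u : 'cV[R]_n), [/\ frob_dot u u = 1, S *m u = s *: u &
    forall k (Y : 'M[R]_(n, k)), frob_dot Y (S *m Y) <= s * frob_dot Y Y].
Proof.
move=> n0 hS.
have [|s [u [u1 Su h]]] := @sym_min_eigen _ (- S) n0; first by rewrite linearN /= hS.
exists (- s), u; split=> //.
  by rewrite scaleNr -Su mulNmx opprK.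
by move=> k Y; have := h k Y; rewrite mulNmx frob_dotNr mulNr lerNr.
Qed.

(** The smallest eigenvalue m of M is a singular value, and it is the least one:
    if M^2 v = t^2 v then |M v| = t |v|, while m |v|^2 <= <v, M v> <= |v| |M v|.
    The largest eigenvalue of M^T M bounds the singular values, so that their
    supremum is at least m. *)
Lemma sigma_min_posdef {n} (M : 'M[R]_n) : (0 < n)%N -> sym_posdef M ->
  [/\ 0 < sigma_min M, 1 <= cond_number M &
   forall k (Y : 'M[R]_(n, k)), sigma_min M * frob_dot Y Y <= frob_dot Y (M *m Y)].
Proof.
move=> n0 [hM Mp].
have [m [u [u1 Mu hm]]] := sym_min_eigen n0 hM.
have u0 : u != 0 by rewrite -frob_dot_eq0 u1 oner_neq0.
have m0 : 0 < m.
  have := Mp _ u0; rewrite -mulmxA Mu -scalemxAr mxE.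
  have <- : frob_dot u u = (u^T *m u) 0 0 by rewrite /frob_dot /mxtrace big_ord1.
  by rewrite u1 mulr1.
have mS : singular_values M m.
  split; first exact: ltW.
  apply/eigenvalueP; exists u^T; last by rewrite -(inj_eq trmx_inj) trmxK trmx0.
  apply: trmx_inj; rewrite linearZ /= !trmx_mul !trmxK hM -mulmxA Mu -scalemxAr Mu.
  by rewrite scalerA expr2.
have eqn t (v : 'rV[R]_n) : v *m (M^T *m M) = t ^+ 2 *: v ->
    frob_dot (M *m v^T) (M *m v^T) = t ^+ 2 * frob_dot v v.
  move=> hv; rewrite frob_dotMl; have <- : (v *m (M^T *m M))^T = M^T *m (M *m v^T).
    by rewrite !trmx_mul trmxK mulmxA.
  by rewrite hv linearZ /= frob_dotZr frob_dot_trmx.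
have lbm : lbound (singular_values M) m.
  move=> t [t0 /eigenvalueP[v hv v0]].
  have /eqn := hv; move=> E.
  have vp : 0 < frob_dot v v by rewrite lt_neqAle frob_dot_ge0 eq_sym frob_dot_eq0 v0.
  have Nv : frob_norm v^T ^+ 2 = frob_dot v v by rewrite frob_norm_sqr frob_dot_trmx.
  have h1 : m * frob_norm v^T ^+ 2 <= frob_norm v^T * frob_norm (M *m v^T).
    by rewrite frob_norm_sqr; apply: le_trans (hm _ _) (frob_dot_le _ _).
  have nv : 0 < frob_norm v^T by rewrite sqrtr_gt0 frob_dot_trmx.
  have E2 : frob_norm (M *m v^T) = t * frob_norm v^T.
    apply/eqP; rewrite -(eqrXn2 (n := 2)) ?frob_norm_ge0 ?mulr_ge0 ?frob_norm_ge0 //.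
    by rewrite frob_norm_sqr exprMn Nv E.
  move: h1; rewrite E2; set a := frob_norm _ in nv *.
  have aa := mulr_gt0 nv nv.
  by move=> h1; rewrite -(ler_pM2r aa); lra.
have minE : sigma_min M = m.
  apply/eqP; rewrite eq_le; apply/andP; split.
    by apply: ge_inf => //; exists m.
  by apply: lb_le_inf => //; exists m.
have MMs : (M^T *m M)^T = M^T *m M by rewrite trmx_mul trmxK.
have [t [w [w1 Mw hM2]]] := sym_max_eigen n0 MMs.
have maxS : m <= sigma_max M.
  (* A singular value r satisfies r^2 <= t, hence r <= t + 1. *)
  apply: ub_le_sup => //; exists (t + 1) => r [r0 /eigenvalueP[v hv v0]].
  have vp : 0 < frob_dot v v by rewrite lt_neqAle frob_dot_ge0 eq_sym frob_dot_eq0 v0.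
  have := hM2 _ v^T; rewrite -mulmxA -frob_dotMl (eqn _ _ hv) frob_dot_trmx ler_pM2r //.
  by nra.
rewrite /cond_number minE; split=> //.
by rewrite ler_pdivlMr // mul1r.
Qed.

(** For 0 <= S <= s this is S^2 <= s S, obtained without diagonalizing S from
    the positivity of S at s Y - S Y. *)
Lemma psd_sqr_le {n} (S : 'M[R]_n) s : S^T = S -> 0 < s ->
  (forall k (Y : 'M[R]_(n, k)), 0 <= frob_dot Y (S *m Y)) ->
  (forall k (Y : 'M[R]_(n, k)), frob_dot Y (S *m Y) <= s * frob_dot Y Y) ->
  forall k (Y : 'M[R]_(n, k)), frob_dot (S *m Y) (S *m Y) <= s * frob_dot Y (S *m Y).
Proof.
move=> hS s0 S0 Ss k Y; set z := S *m Y.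
have := S0 k (s *: Y - z); have := Ss _ z.
rewrite mulmxBr -scalemxAr frob_dotBl !frob_dotBr !frob_dotZl !frob_dotZr.
rewrite -/z.
have -> : frob_dot Y (S *m z) = frob_dot z z by rewrite -[X in X *m z]hS -frob_dotMl.
set a := frob_dot z z; set c := frob_dot z (S *m z); set b := frob_dot Y z.
by move=> h1 h2; rewrite -(ler_pM2l s0); lra.
Qed.

End Spectral.

(** * Estimates used with the eigenpairs *)

Section Aux.
Context {R : realType}.

(** The difference quotients of the gradient in the direction D have norm at most
    Lg |D|, and this passes to the limit. *)
Lemma hess_lip {n p} (f : 'M[R]_(n, p) -> R) Lg X D :
  (forall X Y, frob_norm (grad f X - grad f Y) <= Lg * frob_norm (X - Y)) ->
  differentiable (grad f) X ->
  frob_dot D (hess f X D) <= Lg * frob_dot D D.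
Proof.
move=> lip dX.
have cD : continuous (fun Z : 'M[R]_(n, p) => frob_dot D Z).
  move=> Z; have := is_diff_mxtrace (is_diff_mulmx (is_diff_cst D^T Z) (is_diff_id Z)).
  by case=> h _; exact: (differentiable_continuous h).
have hD : derivable (grad f) X D := diff_derivable dX.
rewrite /hess -deriveE //.
have h := cvg_comp _ _ hD (cD _).
have -> : frob_dot D ('D_D (grad f) X) = lim (frob_dot D
    (h^-1 *: ((grad f \o shift X) (h *: D) - grad f X)) @[h --> 0^']).
  by apply/esym/cvg_lim => //; exact: h.
apply: limr_le; first by apply/cvg_ex; eexists; exact: h.
near=> t.
have t0 : t != 0 by near: t; exact: nbhs_dnbhs_neq.
apply: le_trans (frob_dot_le _ _) _.
rewrite frob_normZ -frob_norm_sqr expr2 mulrA (mulrC Lg) -mulrA.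
apply: ler_wpM2l; first exact: frob_norm_ge0.
rewrite normfV ler_pdivrMl ?normr_gt0 //.
apply: le_trans (lip _ _) _.
by rewrite /= addrK frob_normZ mulrCA.
Unshelve. all: by end_near. Qed.

Lemma left_ker_of_right_ker {n p} (A : 'M[R]_(n, p)) (u : 'cV[R]_p) :
  (p <= n)%N -> u != 0 -> A *m u = 0 -> exists2 w : 'rV[R]_n, w *m A = 0 & w != 0.
Proof.
move=> pn u0 Au.
have rA : (\rank A < p)%N.
  rewrite ltn_neqAle rank_leq_col andbT; apply/negP => /eqP rA.
  have : row_free A^T by rewrite /row_free mxrank_tr rA.
  rewrite -kermx_eq0 => /eqP k0.
  have : (u^T <= kermx A^T)%MS by apply/sub_kermxP; rewrite -trmx_mul Au trmx0.
  by rewrite k0 submx0 -(inj_eq trmx_inj) trmxK trmx0 (negbTE u0).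
have : kermx A != 0.
  rewrite kermx_eq0 /row_free; apply/negP => /eqP e.
  by move: rA; rewrite e ltnNge pn.
by case/rowV0Pn => w /sub_kermxP hw w0; exists w.
Qed.

(** The numerical part of rayleigh_grad_le, where x, a and g stand for the norms
    of X u u^T, of calA M X and of the gradient there, and e for the inner
    product of X u u^T with that gradient. With r = sqrt sigma one has
    r x <= s and (r x) (r a) <= 3 (q + 1) s^2, whence sigma x g is at most
    s^2 (r L0 + 3 (q + 1) Lg), the quantity in the threshold on beta. *)
Lemma grad_bound_scalar (sigma beta Lg q s x a L0 g e : R) :
  0 < sigma -> 0 <= Lg -> 1 <= q -> 0 <= x -> 0 <= a -> 0 <= L0 -> 1 <= s ->
  sigma * x ^+ 2 <= s -> sigma * a ^+ 2 <= 5 / 2 * q * s ^+ 3 ->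
  g <= L0 + Lg * a -> e <= x * g ->
  12 * (3 * (q + 1) * Lg + Num.sqrt sigma * L0) <= beta * sigma ->
  12 * e <= beta * s ^+ 2.
Proof.
move=> sigma0 Lg0 p1 x0 a0 g0 s1 hx ha hg hd bb.
set r := Num.sqrt sigma in bb *.
have r0 : 0 < r by rewrite sqrtr_gt0.
have rr : r * r = sigma by rewrite -expr2 sqr_sqrtr // ltW.
have s0 : 0 <= s by lra.
have r0' : 0 <= r := ltW r0.
have q0 : 0 <= q by lra.
have s22 : 0 <= s ^+ 2 by exact: sqr_ge0.
have rx : r * x <= s.
  rewrite -(@ler_pXn2r _ 2) ?nnegrE ?mulr_ge0 //.
  by rewrite exprMn [r ^+ 2]expr2 rr; apply: le_trans hx _; rewrite expr2 ler_peMl.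
have rxa : (r * x) * (r * a) <= 3 * (q + 1) * s ^+ 2.
  rewrite -(@ler_pXn2r _ 2) ?nnegrE ?mulr_ge0 //; last by lra.
  have -> : (r * x * (r * a)) ^+ 2 = (r * r * x ^+ 2) * (r * r * a ^+ 2) by ring.
  rewrite rr.
  apply: (@le_trans _ _ (s * (5 / 2 * q * s ^+ 3))).
    by apply: ler_pM => //; rewrite mulr_ge0 ?sqr_ge0 // ltW.
  have -> : (3 * (q + 1) * s ^+ 2) ^+ 2 = (3 * (q + 1)) ^+ 2 * s ^+ 4 by ring.
  have -> : s * (5 / 2 * q * s ^+ 3) = 5 / 2 * q * s ^+ 4 by ring.
  apply: ler_wpM2r; first exact: exprn_ge0.
  by rewrite !expr2; nra.
have xg : sigma * (x * g) <= s ^+ 2 * (r * L0 + 3 * (q + 1) * Lg).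
  have h1 : x * g <= x * (L0 + Lg * a) by apply: ler_wpM2l.
  have h2 : sigma * (x * g) <= (r * x) * (r * L0) + Lg * ((r * x) * (r * a)).
    have := ler_wpM2l (ltW sigma0) h1; rewrite -rr; lra.
  have h3 : (r * x) * (r * L0) <= s ^+ 2 * (r * L0).
    apply: ler_wpM2r; first by rewrite mulr_ge0 // ltW.
    by apply: le_trans rx _; rewrite expr2; nra.
  have h4 := ler_wpM2l Lg0 rxa.
  lra.
rewrite -(ler_pM2l sigma0).
have h5 : sigma * e <= sigma * (x * g) by rewrite ler_pM2l.
have s2 : 0 <= s ^+ 2 by exact: sqr_ge0.
have := ler_wpM2l s2 bb; lra.
Qed.

(** The numerical part of sosp_hpen_eigen_ge1 for an eigenvalue 0 < s < 1. The
    first-order equation, divided by 1 - s, gives 3/2 g = beta s (s + 1). After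
    substitution the curvature is
    (1 - s) (9/4 (1 - s) h - beta s (3 s + 1)), and h is too small to make it
    nonnegative. *)
Lemma eigen_contradiction (sigma beta Lg s d g h : R) :
  0 < sigma -> 0 <= Lg -> 0 < beta -> 36 * Lg <= beta * sigma -> 0 < s -> s < 1 ->
  3 / 2 * (1 - s) * g + beta * (s * (s ^+ 2 - 1)) = 0 ->
  sigma * d <= s -> h <= Lg * d ->
  0 <= (3 / 2 * (1 - s)) ^+ 2 * h - 3 * s * g
       + beta * (s * (s ^+ 2 - 1) + 4 * s ^+ 3) ->
  False.
Proof.
move=> sigma0 Lg0 beta0 bs s0 s1 fo hd h0 q0.
have y0 : 0 < 1 - s by lra.
have ge : 3 / 2 * g = beta * (s * (s + 1)).
  have : (1 - s) * (3 / 2 * g - beta * (s * (s + 1))) = 0 by rewrite -fo; ring.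
  by move/eqP; rewrite mulf_eq0 gt_eqF //= subr_eq0 => /eqP.
have q1 : 0 <= (1 - s) * (9 / 4 * (1 - s) * h - beta * s * (3 * s + 1)).
  suff -> : (1 - s) * (9 / 4 * (1 - s) * h - beta * s * (3 * s + 1)) =
      (3 / 2 * (1 - s)) ^+ 2 * h - 2 * s * (3 / 2 * g)
      + beta * (s * (s ^+ 2 - 1) + 4 * s ^+ 3).
    by move: q0; lra.
  by rewrite ge; field.
rewrite pmulr_rge0 // in q1.
have bs0 : 0 < beta * s by rewrite mulr_gt0.
have q2 : beta * s <= 9 / 4 * ((1 - s) * h).
  have : 0 <= beta * s * s by rewrite mulr_ge0 // ltW.
  lra.
have q3 : (1 - s) * (sigma * h) <= (1 - s) * (Lg * s).
  rewrite ler_pM2l //.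
  apply: (@le_trans _ _ (sigma * (Lg * d))); first by rewrite ler_pM2l.
  by rewrite mulrCA; apply: ler_wpM2l.
have q4 : (1 - s) * (Lg * s) <= Lg * s.
  have Ls : 0 <= Lg * s by rewrite mulr_ge0 // ltW.
  by have := mulr_ge0 (ltW s0) Ls; lra.
have q5 : 36 * Lg * s <= beta * sigma * s by rewrite ler_pM2r.
have q6 := ler_wpM2l (ltW sigma0) q2.
have q7 : 0 < beta * sigma * s by rewrite !mulr_gt0.
suff : (0 : R) < 0 by rewrite ltxx.
lra.
Qed.

End Aux.

(** * Stationary points of the penalty function *)

Section Exactness.
Context {R : realType} {n p : nat} (f : 'M[R]_(n, p) -> R) (M : 'M[R]_n).
Context (beta sigma Lg : R).
Context (p0 : (0 < p)%N) (pn : (p <= n)%N).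
Context (M_sym : M^T = M) (f_hess : forall X, hess_exists f X).
Context (f_lip : forall X Y,
    frob_norm (grad f X - grad f Y) <= Lg * frob_norm (X - Y)).
Context (sigma0 : 0 < sigma) (Lg0 : 0 <= Lg) (beta0 : 0 < beta).
Context (M_sigma : forall k (Y : 'M[R]_(n, k)),
  sigma * frob_dot Y Y <= frob_dot Y (M *m Y)).
Context (beta_big : 12 * (3 * (p%:R + 1) * Lg + Num.sqrt sigma * frob_norm (grad f 0))
   <= beta * sigma).
Implicit Types X D : 'M[R]_(n, p).
Local Notation gram := (gram M).
Local Notation dgram := (dgram M).
Local Notation calA_factor := (calA_factor M).
Local Notation dcalA := (dcalA M).
Local Notation gradA := (gradA f M).

(** The form in which the threshold on beta controls the curvature of f. *)
Lemma Lg_le_beta : 36 * Lg <= beta * sigma.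
Proof.
apply: le_trans beta_big.
have : 0 <= Num.sqrt sigma * frob_norm (grad f 0).
  by rewrite mulr_ge0 ?sqrtr_ge0 ?frob_norm_ge0.
have : 0 <= p%:R * Lg by rewrite mulr_ge0.
lra.
Qed.

Lemma hess_le X D : frob_dot D (hess f X D) <= Lg * frob_dot D D.
Proof. by apply: hess_lip => //; case: (f_hess X). Qed.

Lemma gram_ge0 X k (Y : 'M[R]_(p, k)) : 0 <= frob_dot Y (gram X *m Y).
Proof.
rewrite /gram -!mulmxA -(frob_dotMl X Y).
by apply: le_trans (M_sigma _); rewrite mulr_ge0 ?frob_dot_ge0 // ltW.
Qed.

Lemma sigma_dot_mulX X k (Y : 'M[R]_(p, k)) :
  sigma * frob_dot (X *m Y) (X *m Y) <= frob_dot Y (gram X *m Y).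
Proof. by apply: le_trans (M_sigma _) _; rewrite frob_dotMl !mulmxA. Qed.

Lemma frob_dot11 : frob_dot (1%:M : 'M[R]_p) 1%:M = p%:R.
Proof. by rewrite /frob_dot trmx1 mulmx1 mxtrace1. Qed.

(** calA M X = X K with K = 3/2 - S/2, so its squared norm is at most
    s |K|^2 / sigma. Moreover |K|^2 <= p (9/4 + s^2/4) <= 5/2 p s^2, by
    psd_sqr_le and because s >= 1. *)
Lemma calA_norm_le X s : 1 <= s ->
  (forall k (Y : 'M[R]_(p, k)), frob_dot Y (gram X *m Y) <= s * frob_dot Y Y) ->
  sigma * frob_dot (calA M X) (calA M X) <= 5 / 2 * p%:R * s ^+ 3.
Proof.
move=> s1 hs; have s0 : 0 < s by lra.
apply: le_trans (sigma_dot_mulX X (calA_factor X)) _; apply: le_trans (hs _ _) _.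
have h1 := psd_sqr_le (gram_sym M_sym X) s0 (@gram_ge0 X) hs (1%:M : 'M[R]_p).
have h2 := hs _ (1%:M : 'M[R]_p).
have h3 := gram_ge0 X (1%:M : 'M[R]_p).
rewrite frob_dot11 !mulmx1 in h1 h2 h3.
rewrite /calA_factor frob_dotBl !frob_dotBr !frob_dotZl !frob_dotZr.
rewrite (frob_dotC (gram X) (_%:M)) -scalemx1 frob_dotZl frob_dotZr frob_dotZl.
rewrite frob_dot11.
move: h1 h2 h3; set t := frob_dot 1%:M _; set r := frob_dot (gram X) _ => h1 h2 h3.
have s2 : r <= s * s * p%:R by have := ler_wpM2l (ltW s0) h2; lra.
have p1 : 0 <= p%:R :> R by [].
have ss1 : 1 <= s * s by nra.
rewrite !exprS expr0 mulr1.
have hp : p%:R <= p%:R * (s * s) by rewrite ler_peMr.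
have -> : 5 / 2 * p%:R * (s * (s * s)) = s * (5 / 2 * (p%:R * (s * s))) by ring.
by rewrite ler_pM2l //; lra.
Qed.

(** The left-hand side is 12 times the value at u of the quadratic form of
    X^T grad f (calA M X). It is used with s the largest eigenvalue of S, to
    exclude s > 1, and with S = 1, to bound the multiplier of a stationary point
    of (P). *)
Lemma rayleigh_grad_le X s (u : 'cV[R]_p) : 1 <= s ->
  (forall k (Y : 'M[R]_(p, k)), frob_dot Y (gram X *m Y) <= s * frob_dot Y Y) ->
  frob_dot u u = 1 ->
  12 * frob_dot (X *m (u *m u^T)) (gradA X) <= beta * s ^+ 2.
Proof.
move=> s1 hs u1.
have PP : frob_dot (u *m u^T) (u *m u^T) = 1.
  by rewrite frob_dotMl mulmxA (unit_col_mul u1) mul1mx frob_dot_trmx.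
have hx : sigma * frob_norm (X *m (u *m u^T)) ^+ 2 <= s.
  rewrite frob_norm_sqr; apply: le_trans (sigma_dot_mulX _ _) _.
  by apply: le_trans (hs _ _) _; rewrite PP mulr1.
have ha := calA_norm_le s1 hs.
rewrite -frob_norm_sqr in ha.
have hg : frob_norm (gradA X) <= frob_norm (grad f 0) + Lg * frob_norm (calA M X).
  rewrite -[gradA X](subrK (grad f 0)); apply: le_trans (frob_normD _ _) _.
  by rewrite addrC lerD2l; have := f_lip (calA M X) 0; rewrite subr0.
have hd := frob_dot_le (X *m (u *m u^T)) (gradA X).
have x0 := frob_norm_ge0 (X *m (u *m u^T)).
have a0 := frob_norm_ge0 (calA M X).
have g0 := frob_norm_ge0 (grad f 0).
have p1 : 1 <= p%:R :> R by rewrite ler1n.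
exact: (grad_bound_scalar sigma0 Lg0 p1 x0 a0 g0 s1 hx ha hg hd beta_big).
Qed.

Lemma frob_dot_gram_eigen X s k (Y Z : 'M[R]_(p, k)) :
  gram X *m Z = s *: Z -> frob_dot Z (gram X *m Y) = s * frob_dot Z Y.
Proof.
by move=> h; rewrite -[X in X *m Y](gram_sym M_sym X) -frob_dotMl h frob_dotZl.
Qed.

(** Along D = X u u^T, where u is a unit eigenvector of S with eigenvalue s, all
    quantities reduce to scalars: dgram is a multiple of the projector u u^T, and
    dcalA is a multiple of D. *)
Section EigenDirection.
Context (X : 'M[R]_(n, p)) (s : R) (u : 'cV[R]_p).
Context (u1 : frob_dot u u = 1) (Su : gram X *m u = s *: u).
Let P := u *m u^T.
Let D := X *m P.
Let g := frob_dot D (gradA X).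

Lemma proj_sym : P^T = P.
Proof. by rewrite trmx_mul trmxK. Qed.

Lemma proj_idem : P *m P = P.
Proof.
by rewrite /P -mulmxA (mulmxA u^T) (unit_col_mul u1) mul1mx.
Qed.

Lemma gram_proj : gram X *m P = s *: P.
Proof. by rewrite mulmxA Su scalemxAl. Qed.

Lemma proj_gram : P *m gram X = s *: P.
Proof.
apply: trmx_inj; rewrite trmx_mul (gram_sym M_sym) proj_sym gram_proj linearZ /=.
by rewrite proj_sym.
Qed.

Lemma frob_dot_proj1 : frob_dot P 1%:M = 1.
Proof. by rewrite frob_dotC /frob_dot trmx1 mul1mx mxtrace_mulC. Qed.

Lemma frob_dot_proj : frob_dot P P = 1.
Proof.
by rewrite -[RHS]frob_dot_proj1 -[in RHS]proj_idem frob_dotMl proj_sym mulmx1.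
Qed.

Lemma frob_dot_proj_gram2 : frob_dot P (gram X *m gram X - 1%:M) = s ^+ 2 - 1.
Proof.
rewrite frob_dotBr frob_dot_proj1; congr (_ - _).
rewrite (frob_dot_gram_eigen _ gram_proj) -[X in frob_dot P X]mulmx1.
by rewrite (frob_dot_gram_eigen _ gram_proj) frob_dot_proj1 mulr1 expr2.
Qed.

Lemma frob_dotXP (Y : 'M[R]_p) : frob_dot D (M *m X *m Y) = s * frob_dot P Y.
Proof.
by rewrite /D frob_dotMl !mulmxA -/(gram X) (frob_dot_gram_eigen _ gram_proj).
Qed.

Lemma dgram_proj : dgram X D = (2 * s) *: P.
Proof.
rewrite /dgram /D mulmxA -/(gram X) gram_proj.
rewrite !trmx_mul -!mulmxA (mulmxA X^T) -/(gram X).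
by rewrite mulmxA -trmx_mul -/P proj_sym proj_gram -scalerDl; congr (_ *: _); ring.
Qed.

Lemma dcalA_proj : dcalA X D = (3 / 2 * (1 - s)) *: D.
Proof.
rewrite /dcalA dgram_proj /calA_factor mulmxBr -!scalemxAr /D mul_mx_scalar.
rewrite -mulmxA proj_gram -scalemxAr -/D !scalerA -!scalerBl; congr (_ *: _).
by field.
Qed.

Lemma hpen_grad_proj : frob_dot D (hpen_grad f M beta X) =
  3 / 2 * (1 - s) * g + beta * (s * (s ^+ 2 - 1)).
Proof.
rewrite /hpen_grad frob_dotDr -dcalA_adjE // dcalA_proj frob_dotZl -/g.
by rewrite frob_dotZr frob_dotXP frob_dot_proj_gram2.
Qed.

Lemma hpen_hess_proj : frob_dot D (hess (hpen f M beta) X D) =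
  (3 / 2 * (1 - s)) ^+ 2 * frob_dot D (hess f (calA M X) D) - 3 * s * g
  + beta * (s * (s ^+ 2 - 1) + 4 * s ^+ 3).
Proof.
apply: (etrans (hess_hpen_quad beta M_sym f_hess X D)).
rewrite dcalA_proj dgram_proj.
have -> : hess f (calA M X) ((3 / 2 * (1 - s)) *: D) =
    (3 / 2 * (1 - s)) *: hess f (calA M X) D by rewrite /hess linearZ.
have gE : frob_dot P (D^T *m gradA X) = g.
  by rewrite -frob_dotMl -(mulmxA X) proj_idem.
have E Y : frob_dot D (M *m D *m Y) = s * frob_dot P Y.
  rewrite mulmxA -(mulmxA (M *m X)) frob_dotXP; congr (_ * _).
  by rewrite -[X in X *m Y]proj_sym -frob_dotMl proj_idem.
rewrite !E (frob_dot_symm _ proj_sym) -(frob_dotMl X) -/D -/g frob_dot_proj_gram2.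
rewrite -scalemxAr gram_proj !(frob_dotZl, frob_dotZr) gE frob_dot_proj.
by ring.
Qed.

End EigenDirection.

(** For 0 < s < 1 the direction X u u^T has negative curvature. For s = 0 that
    direction vanishes, because X u = 0. But then X has rank less than p <= n, so
    some w <> 0 has w M X = 0; the direction w^T u^T leaves S fixed to first
    order, and its curvature is at most 9/4 Lg |D|^2 - beta <D, M D> < 0. *)
Lemma sosp_hpen_eigen_ge1 X s (u : 'cV[R]_p) : sosp (hpen f M beta) X ->
  frob_dot u u = 1 -> gram X *m u = s *: u -> 0 <= s -> 1 <= s.
Proof.
move=> [_]; rewrite grad_hpenE // => X0 Xpos u1 Su s0; rewrite leNgt; apply/negP => s1.
have bs := Lg_le_beta.
move: s0; rewrite le_eqVlt => /orP[/eqP s0|s0].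
- have u0 : u != 0 by rewrite -frob_dot_eq0 u1 oner_neq0.
  have Su0 : gram X *m u = 0 by rewrite Su -s0 scale0r.
  have Xu : X *m u = 0.
    apply/eqP; rewrite -frob_dot_eq0 eq_le frob_dot_ge0 andbT.
    have := sigma_dot_mulX X u; rewrite Su0 frob_dot0r.
    by rewrite pmulr_rle0.
  have [|w wMX w0] := left_ker_of_right_ker (A := M *m X) pn u0.
    by rewrite -mulmxA Xu mulmx0.
  pose D := w^T *m u^T.
  have DMX : D^T *m M *m X = 0.
    by rewrite trmx_mul !trmxK -!mulmxA wMX mulmx0.
  have dg : dgram X D = 0.
    rewrite /dgram DMX addr0 -[LHS]trmxK (trmx_mul _ D) (trmx_mul X^T M) trmxK.
    by rewrite M_sym mulmxA DMX trmx0.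
  have DS : D *m gram X = 0.
    by rewrite -mulmxA -[u^T *m _]trmxK trmx_mul trmxK gram_sym // Su0 trmx0 mulmx0.
  have dA : dcalA X D = (3 / 2) *: D.
    rewrite /dcalA dg mulmx0 scaler0 subr0 /calA_factor mulmxBr -scalemxAr DS.
    by rewrite scaler0 subr0 mul_mx_scalar.
  have := Xpos D; rewrite [X in 0 <= X](hess_hpen_quad beta M_sym f_hess X D) dA dg.
  have -> : hess f (calA M X) ((3 / 2) *: D) = (3 / 2) *: hess f (calA M X) D.
    by rewrite /hess linearZ.
  rewrite !frob_dot0l frob_dotZl frob_dotZr.
  have -> : frob_dot D (M *m D *m symm_part (X^T *m gradA X)) = 0.
    have XD : X *m D^T = 0 by rewrite trmx_mul !trmxK mulmxA Xu mul0mx.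
    have e Y : frob_dot D (M *m D *m Y) = frob_dot (D^T *m M *m D) Y.
      by rewrite frob_dotC frob_dotMl frob_dotC trmx_mul M_sym.
    rewrite e frob_dot_symm; first by rewrite -frob_dotMl !mulmxA XD !mul0mx frob_dot0l.
    by rewrite (trmx_mul _ D) (trmx_mul D^T M) trmxK M_sym mulmxA.
  have -> : M *m D *m (gram X *m gram X - 1%:M) = - (M *m D).
    by rewrite mulmxBr mulmx1 (mulmxA _ (gram X)) -(mulmxA M D) DS mulmx0 mul0mx sub0r.
  have Dp : 0 < frob_dot D D.
    have Du : D *m u = w^T by rewrite -mulmxA (unit_col_mul u1) mulmx1.
    rewrite lt_neqAle frob_dot_ge0 andbT eq_sym frob_dot_eq0; apply: contra w0.
    by move=> /eqP D0; rewrite -(inj_eq trmx_inj) trmx0 -Du D0 mul0mx.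
  rewrite frob_dotNr => hq.
  have h1 := hess_le (calA M X) D.
  have h2 := ler_wpM2l (ltW beta0) (M_sigma D).
  have h3 : 36 * (Lg * frob_dot D D) <= beta * (sigma * frob_dot D D).
    by rewrite !mulrA ler_pM2r.
  have h4 : 0 < beta * (sigma * frob_dot D D) by rewrite !mulr_gt0.
  suff : (0 : R) < 0 by rewrite ltxx.
  lra.
have fo := hpen_grad_proj u1 Su; have so := hpen_hess_proj u1 Su.
have hd := sigma_dot_mulX X (u *m u^T).
rewrite (gram_proj Su) frob_dotZr (frob_dot_proj u1) mulr1 in hd.
have h0 := hess_le (calA M X) (X *m (u *m u^T)).
have q0 := Xpos (X *m (u *m u^T)).
rewrite so in q0; rewrite X0 frob_dot0r in fo.
exact: (eigen_contradiction sigma0 Lg0 beta0 bs s0 s1 (esym fo) hd h0 q0).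
Qed.

(** The least eigenvalue of S is at least 1 by sosp_hpen_eigen_ge1. If the largest
    one, t, exceeded 1, the first-order condition along its eigenvector would
    read 3/2 g = beta t (t + 1), against 12 g <= beta t^2. Hence S = 1. *)
Lemma sosp_hpen_feasible X : sosp (hpen f M beta) X -> gram X = 1%:M.
Proof.
move=> hX.
have [t [v [v1 Sv ht]]] := sym_max_eigen p0 (gram_sym M_sym X).
have [s [u [u1 Su hs]]] := sym_min_eigen p0 (gram_sym M_sym X).
have s0 : 0 <= s by have := gram_ge0 X u; rewrite Su frob_dotZr u1 mulr1.
have s1 : 1 <= s := sosp_hpen_eigen_ge1 hX u1 Su s0.
have t1 : t <= 1.
  rewrite leNgt; apply/negP => t1.
  have [_] := hX; rewrite grad_hpenE // => X0 _.
  have fo := hpen_grad_proj v1 Sv.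
  rewrite X0 frob_dot0r in fo.
  have := rayleigh_grad_le (ltW t1) ht v1.
  move: fo; set g := frob_dot _ _ => fo hg.
  have : (1 - t) * (3 / 2 * g - beta * (t * (t + 1))) = 0 by rewrite fo; ring.
  move/eqP; rewrite mulf_eq0 subr_eq0 lt_eqF //= subr_eq0 => /eqP ge.
  have tt : 0 < beta * t ^+ 2 by rewrite mulr_gt0 // exprn_gt0 // (lt_trans _ t1).
  have bt : 0 < beta * t by rewrite mulr_gt0 // (lt_trans _ t1).
  suff : (0 : R) < 0 by rewrite ltxx.
  lra.
apply/eqP; rewrite -subr_eq0; apply/eqP; rewrite -[LHS]mulmx1.
apply: psd_ker.
- by rewrite linearB /= gram_sym // trmx1.
- move=> Y; rewrite mulmxBl mul1mx frob_dotBr subr_ge0.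
  by apply: le_trans (hs _ Y); rewrite ler_peMl ?frob_dot_ge0.
- have h1 := ht _ (1%:M : 'M[R]_p); have h2 := hs _ (1%:M : 'M[R]_p).
  rewrite mulmxBl mul1mx frob_dotBr; apply/eqP; rewrite subr_eq0 eq_le.
  apply/andP; split.
    by apply: le_trans h1 _; rewrite ler_piMl ?frob_dot_ge0.
  by apply: le_trans h2; rewrite ler_peMl ?frob_dot_ge0.
Qed.

Section Feasible.
Context (X : 'M[R]_(n, p)) (S1 : gram X = 1%:M).

Lemma calA_factor_feasible : calA_factor X = 1%:M.
Proof.
rewrite /calA_factor S1 -scalemx1 -scalerBl -[RHS]scale1r.
by congr (_ *: _); field.
Qed.

Lemma calA_feasible : calA M X = X.
Proof. by rewrite -[LHS]/(X *m calA_factor X) calA_factor_feasible mulmx1. Qed.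

Lemma gradA_feasible : gradA X = grad f X.
Proof. by rewrite /gradA calA_feasible. Qed.

Lemma hpen_grad_feasible : hpen_grad f M beta X =
  grad f X - M *m X *m symm_part (X^T *m grad f X).
Proof.
rewrite /hpen_grad S1 mulmx1 subrr mulmx0 scaler0 addr0 /dcalA_adj.
by rewrite calA_factor_feasible mulmx1 gradA_feasible.
Qed.

Lemma fosp_P_hpen : fosp_P f M X <-> grad (hpen f M beta) X = 0.
Proof. by rewrite grad_hpenE // hpen_grad_feasible; split=> [[]//|h]; split. Qed.

Lemma tangentP T : tangent M X T <-> dgram X T = 0.
Proof.
have -> : dgram X T = 2 *: symm_part (T^T *m M *m X).
  rewrite dgram_symm //; congr (_ *: _); rewrite /symm_part addrC.
  by rewrite !trmx_mul !trmxK M_sym !mulmxA.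
by split=> [->|/eqP]; rewrite ?scaler0 // scaler_eq0 pnatr_eq0 /= => /eqP.
Qed.

Lemma dcalA_feasible D : dcalA X D = D - 2^-1 *: (X *m dgram X D).
Proof. by rewrite /dcalA calA_factor_feasible mulmx1. Qed.

Lemma dgramB D E : dgram X (D - E) = dgram X D - dgram X E.
Proof. by rewrite /dgram mulmxBr [(D - E)^T]linearB /= !mulmxBl opprD addrACA. Qed.

Lemma dgram_mulX (Q : 'M[R]_p) : dgram X (X *m Q) = Q + Q^T.
Proof.
rewrite /dgram mulmxA -/(gram X) S1 mul1mx; congr (_ + _).
by rewrite trmx_mul -(mulmxA Q^T) -(mulmxA Q^T) -/(gram X) S1 mulmx1.
Qed.

(** At a feasible point dcalA is the projection onto the tangent space. *)
Lemma dgram_dcalA D : dgram X (dcalA X D) = 0.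
Proof.
rewrite dcalA_feasible dgramB scalemxAr dgram_mulX linearZ /= dgram_sym //.
rewrite -scalerDl -[X in X - _]scale1r -scalerBl.
have -> : 1 - (2^-1 + 2^-1) = 0 :> R by field.
by rewrite scale0r.
Qed.

(** Split D = T + X Q with T tangent and Q symmetric. Tangency makes
    K = T^T M X skew; this cancels the cross terms and leaves the Hessian form
    of (P) at T plus a form in the normal part Q only. *)
Lemma hess_hpen_feasible D : fosp_P f M X ->
  let T := dcalA X D in
  let Q := 2^-1 *: dgram X D in
  frob_dot D (hess (hpen f M beta) X D) =
  frob_dot T (hess f X T - M *m T *m X^T *m grad f X)
  + (4 * beta * frob_dot Q Q - 3 * frob_dot Q (symm_part (X^T *m grad f X) *m Q)).
Proof.
move=> [_ /eqP]; rewrite subr_eq0 => /eqP hG T Q.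
set L := symm_part _ in hG *.
have XG : X^T *m grad f X = L by rewrite hG !mulmxA -/(gram X) S1 mul1mx.
have L_sym : L^T = L by rewrite symm_part_sym.
have Q_sym : Q^T = Q by rewrite linearZ /= dgram_sym.
have hQ : dgram X D = 2 *: Q by rewrite scalerA mulfV ?pnatr_eq0 // scale1r.
have hD : D = T + X *m Q by rewrite /T dcalA_feasible -scalemxAr subrK.
pose K := T^T *m M *m X.
have K_skew : X^T *m M *m T = - K.
  by apply/eqP; rewrite -addr_eq0; apply/eqP; exact: dgram_dcalA.
have KT : K^T = - K by rewrite -K_skew !trmx_mul trmxK M_sym mulmxA.
rewrite hess_hpen_quad // calA_feasible gradA_feasible -/T S1 mulmx1 subrr mulmx0.
rewrite mul1mx frob_dot0r -(mulmxA (M *m T)) -/L XG frob_dotBr hQ add0r.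
have -> : D^T *m grad f X = K *m L + Q *m L.
  rewrite {1}hD linearD /= trmx_mul Q_sym mulmxDl; congr (_ + _).
    by rewrite hG !mulmxA.
  by rewrite -mulmxA XG.
have -> : frob_dot D (M *m D *m L) = frob_dot T (M *m T *m L) - 2 * frob_dot Q (K *m L)
    + frob_dot Q (L *m Q).
  have sw : frob_dot K (Q *m L) = frob_dot Q (K *m L).
    by rewrite [RHS]frob_dotC frob_dotMr L_sym.
  have e1 : frob_dot T (M *m (X *m Q) *m L) = - frob_dot Q (K *m L).
    rewrite -sw -frob_dotNl -KT /K !trmx_mul !trmxK M_sym.
    by rewrite frob_dotMl frob_dotMl trmxK M_sym !mulmxA.
  have e2 : frob_dot (X *m Q) (M *m T *m L) = - frob_dot Q (K *m L).
    by rewrite frob_dotMl !mulmxA K_skew mulNmx frob_dotNr.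
  have e3 : frob_dot (X *m Q) (M *m (X *m Q) *m L) = frob_dot Q (L *m Q).
    rewrite frob_dotMl !mulmxA -/(gram X) S1 mul1mx.
    by rewrite -frob_dot_trmx trmx_mul Q_sym L_sym.
  rewrite {1 2}hD mulmxDr mulmxDl frob_dotDl !frob_dotDr e1 e2 e3; ring.
have -> : frob_dot (2 *: Q) (K *m L + Q *m L) =
    2 * (frob_dot Q (K *m L) + frob_dot Q (L *m Q)).
  rewrite frob_dotZl frob_dotDr; congr (_ * (_ + _)).
  by rewrite -[LHS]frob_dot_trmx trmx_mul Q_sym L_sym.
rewrite (frob_dotZl 2) (frob_dotZr 2).
ring.
Qed.

End Feasible.

End Exactness.

(** * Equality of the second-order stationary points *)

Theorem theorem3p14 (R : realType) (n p : nat) (hp : (1 <= p)%N)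
  (hpn : (p <= n)%N)
  (d1 : measure_display) (T1 : measurableType d1) (Xi : probability T1 R)
  (d2 : measure_display) (T2 : measurableType d2) (Theta : probability T2 R)
  (fxi : T1 -> 'M[R]_(n, p) -> R) (f : 'M[R]_(n, p) -> R)
  (Mtheta : T2 -> 'M[R]_n) (M : 'M[R]_n)
  (hf : forall X, has_mean Xi (fun xi => fxi xi X) (f X))
  (hM : has_mean_mx Theta Mtheta M)
  (Lg : R)
  (f_diff : forall X, differentiable f X)
  (f_lip : forall X Y,
    frob_norm (grad f X - grad f Y) <= Lg * frob_norm (X - Y))
  (fxi_diff : {ae Xi, forall xi, forall X, differentiable (fxi xi) X})
  (fxi_grad : forall X, has_mean_mx Xi (fun xi => grad (fxi xi) X) (grad f X))
  (M_pd : sym_posdef M)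
  (f_hess : forall X, hess_exists f X)
  (tbeta beta : R)
  (htbeta : 12 * cond_number M
      * (3 * (p%:R + 1) * Lg + Num.sqrt (sigma_min M) * frob_norm (grad f 0))
      / sigma_min M <= tbeta)
  (beta_gt0 : 0 < beta) (hbeta : tbeta <= beta)
  (X : 'M[R]_(n, p)) :
  sosp (hpen f M beta) X <-> sosp_P f M X.
Proof.
have n0 : (0 < n)%N := leq_trans hp hpn.
have M_sym := M_pd.1.
have [sigma0 kap M_sigma] := sigma_min_posdef n0 M_pd.
have Lg0 : 0 <= Lg.
  (* Compare the gradients at two distinct points. *)
  have := f_lip (const_mx 1) 0; rewrite subr0 => h.
  have c0 : 0 < frob_norm (const_mx 1 : 'M[R]_(n, p)).
    rewrite lt_neqAle frob_norm_ge0 andbT eq_sym -sqrf_eq0 frob_norm_sqr frob_dot_eq0.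
    apply/eqP => /matrixP /(_ (Ordinal n0) (Ordinal hp)); rewrite !mxE => /eqP.
    by rewrite oner_eq0.
  by rewrite -(pmulr_lge0 _ c0); apply: le_trans (frob_norm_ge0 _) h.
pose E := 3 * (p%:R + 1) * Lg + Num.sqrt (sigma_min M) * frob_norm (grad f 0).
have beta_big : 12 * E <= beta * sigma_min M.
  have E0 : 0 <= E.
    by rewrite addr_ge0 ?mulr_ge0 ?sqrtr_ge0 ?frob_norm_ge0 ?addr_ge0.
  have := le_trans htbeta hbeta; rewrite ler_pdivrMr //; apply: le_trans.
  by rewrite -(mulrA 12 (cond_number M)) ler_pM2l // ler_peMl.
split=> [hX|[hfo hso]].
  have S1 := sosp_hpen_feasible hp hpn M_sym f_hess f_lip sigma0 Lg0 beta_gt0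
    M_sigma beta_big hX.
  have [_ g0 h0] := hX.
  have hfo : fosp_P f M X by apply/(fosp_P_hpen beta M_sym f_hess S1).
  split=> // T /(tangentP M_sym) dT.
  have := h0 T; rewrite [X in 0 <= X](hess_hpen_feasible beta M_sym f_hess S1 T hfo).
  rewrite (dcalA_feasible S1) dT mulmx0 !scaler0 subr0 mulmx0 !frob_dot0r.
  by rewrite !mulr0 subr0 addr0.
have S1 : gram M X = 1%:M by case: hfo.
split; first exact: hess_exists_hpen.
  exact/(fosp_P_hpen beta M_sym f_hess S1).
move=> D; rewrite [X in 0 <= X](hess_hpen_feasible beta M_sym f_hess S1 D hfo).
apply: addr_ge0.
  by apply: hso; apply/(tangentP M_sym); exact: dgram_dcalA.
(* On the normal part it suffices that the largest eigenvalue of the multiplier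
   is at most 4/3 beta; the gradient estimate even gives beta / 12. *)
set Q := 2^-1 *: _.
have [l [u [u1 Lu hl]]] := sym_max_eigen hp (symm_part_sym (X^T *m grad f X)).
have l_le : 12 * l <= beta.
  have hs k (Y : 'M[R]_(p, k)) : frob_dot Y (gram M X *m Y) <= 1 * frob_dot Y Y.
    by rewrite S1 !mul1mx mul1r.
  have := rayleigh_grad_le hp M_sym f_lip sigma0 Lg0 M_sigma beta_big (lexx 1) hs u1.
  rewrite expr1n mulr1; apply: le_trans; rewrite ler_pM2l // (gradA_feasible f S1).
  rewrite frob_dotMl -(frob_dot_symm _ (proj_sym u)) frob_dotMr trmxK.
  by rewrite Lu frob_dotZr u1 mulr1.
have := hl _ Q; have := ler_wpM2r (frob_dot_ge0 Q) l_le.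
have := mulr_ge0 (ltW beta_gt0) (frob_dot_ge0 Q).
move: (frob_dot Q Q) (frob_dot Q (_ *m Q)) => a b; lra.
Qed.
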